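(* Let $\mathbf{G}$ be an abelian group, $A\subseteq\mathbf{G}$ a finite nonempty set, $\beta\in[0,1]$ and $\gamma\in(0,1]$. Suppose that $A$ is $(2,\beta,\gamma)$-connected with $\beta\le1/2$. Put $L=\log(4|A|^3\mathsf{E}(A)^{-1})$. Then there are real numbers $\Delta,\Delta^*>0$ such that the level sets $$P=\{x: \Delta/2<|A_x|\le\Delta\},\qquad P^*=\{x: \Delta^*/2<|A_x|\le\Delta^*\}$$ are $2^{-6}\gamma L^{-2}$-popular dual sets and $$\Delta\Delta^*\le\frac{2^8L^2\,\mathsf{E}(A)}{\gamma|A|},$$ $$L^{-5}\gamma^3 2^{-21}|A|^2\le|P|\,|P^*|,$$ $$L^{-3}\gamma^22^{-13}\,\mathsf{E}(A)|A|\le\sigma_P(A)\,\sigma_{P^*}(A).$$ Further, for every $s\in[1,2]$, $$\mathsf{E}_s(A)\ge2^{-5}\gamma\,|A|^{1-s/2}\,\mathsf{E}(A)^{s/2}.$$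
   Context: Sets are identified with their characteristic functions; logarithms are to base $2$. $A_x=A\cap(A-x)$; for real $s\ge1$, $\mathsf{E}_s(A)=\sum_{x:A_x\ne\emptyset}|A_x|^s$ and $\mathsf{E}(A)=\mathsf{E}_2(A)$. For $P\subseteq\mathbf{G}$, $\sigma_P(A)=\sum_{x\in P}|A_x|$. Sets $P,P^*\subseteq\mathbf{G}$ are called $c$-popular dual (for $A$) if $$c\,\mathsf{E}(A)\le\sum_{x,y}P(x-y)A(x)A(y)\sum_zP^*(z)A(x+z)A(y+z).$$ For real $\alpha>1$ and $\beta,\gamma\in[0,1]$, the set $A$ is called $(\alpha,\beta,\gamma)$-connected if for every $B\subseteq A$ with $|B|\ge\beta|A|$ one has $\mathsf{E}_\alpha(B)\ge\gamma\left(|B|/|A|\right)^{2\alpha}\mathsf{E}_\alpha(A)$. *)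

(* Defs.v *)
From HB Require Import structures.
From mathcomp Require Export all_boot all_order all_algebra finmap.
From mathcomp Require Export all_classical all_reals all_analysis.

Set Implicit Arguments.
Unset Strict Implicit.
Unset Printing Implicit Defensive.

Import Order.TTheory GRing.Theory Num.Theory.
Local Open Scope classical_set_scope.
Local Open Scope ring_scope.

(* The sums \sum_(x \in P) below range over possibly infinite sets. All their
   summands vanish outside the finite sets A or A - A, so the library's sum over
   the support is the actual sum. *)

Definition log2 (R : realType) (x : R) : R := ln x / ln 2.

(* A_x = A \cap (A - x) *)
Definition shift_inter (G : zmodType) (A : {fset G}) (x : G) : {fset G} :=
  (A `&` [fset (a - x)%R | a in A])%fset.

Definition energy (R : realType) (G : zmodType) (s : R) (A : {fset G}) : R :=
  \sum_(x \in [set x : G | shift_inter A x != fset0])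
    (#|` shift_inter A x|%:R `^ s).

Definition sigma_on (R : realType) (G : zmodType) (P : set G) (A : {fset G})
  : R := \sum_(x \in P) (#|` shift_inter A x|%:R : R).

Definition popular_dual (R : realType) (G : zmodType) (c : R) (A : {fset G})
    (P Pstar : set G) : Prop :=
  let ind (S : set G) : G -> R := \1_S in
  c * energy 2 A <=
  \sum_(x \in [set: G]) \sum_(y \in [set: G])
    (ind P (x - y) * ind [set` A] x * ind [set` A] y *
     \sum_(z \in [set: G])
       (ind Pstar z * ind [set` A] (x + z) * ind [set` A] (y + z))).

Definition energy_connected (R : realType) (G : zmodType)
    (alpha beta gamma : R) (A : {fset G}) : Prop :=
  forall B : {fset G}, (B `<=` A)%fset ->
    beta * #|` A|%:R <= #|` B|%:R ->
    gamma * ((#|` B|%:R / #|` A|%:R) `^ (2 * alpha)) * energy alpha A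
      <= energy alpha B.

Definition level_set (R : realType) (G : zmodType) (A : {fset G}) (Delta : R)
  : set G :=
  [set x : G | Delta / 2 < #|` shift_inter A x|%:R /\
               #|` shift_inter A x|%:R <= Delta].

(* |P| for finite P; fset_set sends an infinite set to the empty one. The level
   sets are finite whenever Delta > 0, since A_x is empty off A - A. *)
Definition set_card (G : zmodType) (P : set G) : nat := #|` fset_set P|.

(* Main.v *)
From mathcomp Require Import ring lra.
Require Import Defs.
Import Order.TTheory GRing.Theory Num.Theory.
Local Open Scope classical_set_scope.
Local Open Scope ring_scope.

Set Implicit Arguments.
Unset Strict Implicit.
Unset Printing Implicit Defensive.

(** For x in A put r(w) = |A_w| and e(x) = sum over y in A of r(x - y); e(x) is
    also the number of parallelograms (x, y, u, y + u - x) in A with vertex x, and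
    the e(x) sum to E.  Let B consist of the x in A with e(x) <= 4E/|A|.  By Markov
    |B| >= 3|A|/4, so connectedness gives E(B) >= gamma (|B|/|A|)^4 E.  The
    parallelograms of B one of whose sides w has small r(w) are few; splitting the
    others according to the dyadic sizes of r at both sides, the pigeonhole
    principle first gives P, keeping a 1/L proportion, and then P^*, keeping a
    1/L^2 proportion.  On B the number of y with x - y in P is at most 2e(x)/Delta,
    which bounds the popular parallelograms from above.  If gamma <= E/|A|^3
    the trivial bounds Delta, Delta^* <= |A| suffice, with B = A.

    For E_s, the parallelograms with side differences w, z are given the weight
    (r(w) r(z))^(s/2 - 1).  Their total is at most E_s by AM-GM, and convexity of
    t^(s/2 - 1) bounds it below at each vertex in B, since the sum of r(w) r(z)
    over the parallelograms at x is at most e(x)^2. *)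

(** * Representations of group elements as differences in a finite set *)

Section Representations.
Variables (R : realType) (G : zmodType).
Implicit Types (A B : {fset G}) (P Q : pred G) (f : G -> R).

Definition rep A (w : G) : R := \sum_(x <- A) (x + w \in A)%:R.

Lemma card_sum A : #|` A|%:R = \sum_(x <- A) (1 : R).
Proof. by rewrite card_fset_sum1 natr_sum. Qed.

Lemma shift_interE A w : shift_inter A w = [fset x in A | (x + w)%R \in A]%fset.
Proof.
apply/fsetP => x; rewrite /shift_inter !inE /=; congr (_ && _).
apply/imfsetP/idP => [[y /= yA ->]|xwA]; first by rewrite subrK.
by exists (x + w) => //; rewrite addrK.
Qed.

Lemma card_shift_inter A w : #|` shift_inter A w|%:R = rep A w.
Proof.
rewrite card_sum shift_interE -big_fset_condE /= big_mkcond /=.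
by apply: eq_bigr => x _; case: ifP.
Qed.

Lemma rep_ge0 A w : 0 <= rep A w.
Proof. by apply: sumr_ge0 => x _; rewrite ler0n. Qed.

Lemma rep_le_card A w : rep A w <= #|` A|%:R.
Proof. by rewrite card_sum; apply: ler_sum => x _; case: (_ \in _); rewrite ?ler01. Qed.

Lemma rep_sub_ge1 A x y : x \in A -> y \in A -> 1 <= rep A (x - y).
Proof.
move=> xA yA; rewrite /rep (big_fsetD1 y) //= subrKC xA.
by rewrite lerDl; apply: sumr_ge0 => z _; rewrite ler0n.
Qed.

Lemma sum_fset_delta A (z : G) f : \sum_(x <- A) ((z == x)%:R * f x) = (z \in A)%:R * f z.
Proof.
case: (boolP (z \in A)) => zA.
  rewrite (big_fsetD1 z) //= eqxx big_seq big1 ?addr0 // => x.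
  by rewrite !inE eq_sym => /andP[/negbTE -> _]; rewrite mul0r.
rewrite big_seq big1 ?mul0r // => x xA.
by case: eqVneq => [zx|_]; rewrite ?mul0r //; rewrite zx xA in zA.
Qed.

(** Substitution y = x + v. Writing the membership test as a sum of deltas over A reduces it to an
    exchange of two finite sums, with no bijection between index sets. *)
Lemma sum_shift A (v : G) f :
  \sum_(x <- A) (x + v \in A)%:R * f (x + v) = \sum_(x <- A) (x - v \in A)%:R * f x.
Proof.
under eq_bigr do rewrite -sum_fset_delta.
rewrite exchange_big /=; apply: eq_bigr => y _.
rewrite -(sum_fset_delta A (y - v) (fun=> f y)).
by apply: eq_bigr => x _; rewrite (can2_eq (addrK v) (subrK v)) eq_sym.
Qed.

Lemma repN A w : rep A (- w) = rep A w.
Proof.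
transitivity (\sum_(x <- A) (x - w \in A)%:R * (1 : R)).
  by apply: eq_bigr => x _; rewrite mulr1.
by rewrite -(sum_shift A w (fun=> 1)); apply: eq_bigr => x _; rewrite mulr1.
Qed.

Definition diffs A : {fset G} := [fset (x - y)%R | x in A, y in A]%fset.

Lemma rep_eq0 A w : w \notin diffs A -> rep A w = 0.
Proof.
move=> wD; rewrite /rep big_seq big1 // => x xA.
case: (boolP (x + w \in A)) => // xwA; case/negP: wD.
by apply/imfset2P; exists (x + w) => //; exists x => //; rewrite addrAC subrr add0r.
Qed.

(** Pairs are grouped by their difference, and w arises from [rep A w] pairs. This is the bridge
    from sums over the group to double sums over A. *)
Lemma sum_sub A f :
  \sum_(x <- A) \sum_(y <- A) f (x - y) = \sum_(w <- diffs A) rep A w * f w.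
Proof.
rewrite exchange_big /=; under [RHS]eq_bigr do rewrite /rep mulr_suml.
rewrite [RHS]exchange_big /=; apply: eq_big_seq => y yA.
transitivity (\sum_(x <- A) \sum_(w <- diffs A) (x - y == w)%:R * f w).
  apply: eq_big_seq => x xA; rewrite sum_fset_delta.
  suff -> : x - y \in diffs A by rewrite mul1r.
  by apply/imfset2P; exists x => //; exists y.
rewrite exchange_big /=; apply: eq_bigr => w _.
rewrite -(sum_fset_delta A (y + w) (fun=> f w)).
by apply: eq_bigr => x _; rewrite subr_eq [w + y]addrC eq_sym.
Qed.

End Representations.

(** * Energy, sigma and popular duality as finite sums over A *)

Section Translation.
Variables (R : realType) (G : zmodType).
Implicit Types (A B : {fset G}) (P Q : pred G).

(* Weighted count of the parallelograms x, y, u, y + u - x in A with a given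
   vertex x; the weights are attached to the two sides through x. *)
Definition fiber A (f g : G -> R) (x : G) : R := \sum_(y <- A) \sum_(u <- A)
  f (x - y) * g (u - x) * (y + (u - x) \in A)%:R.

Definition quad A (f g : G -> R) : R := \sum_(x <- A) fiber A f g x.

Lemma rep_gt0 A w : w \in diffs A -> 0 < rep R A w.
Proof.
case/imfset2P => x /= xA [y yA ->]; apply: lt_le_trans ltr01 _.
exact: rep_sub_ge1.
Qed.

Lemma shift_inter_neq0 A w : (shift_inter A w != fset0) = (w \in diffs A).
Proof.
apply/idP/idP => [|/rep_gt0]; last first.
  by apply: contraTneq => A0; rewrite -card_shift_inter A0 cardfs0 ltxx.
apply: contraNT => /(@rep_eq0 R); rewrite -card_shift_inter => /eqP.
by rewrite pnatr_eq0 cardfs_eq0.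
Qed.

(** One factor of [rep] pays for the pairs with a given difference, leaving the exponent s - 1. On
    [diffs A] the base is positive, so exponents add. *)
Lemma energyE A (s : R) :
  energy s A = \sum_(x <- A) \sum_(y <- A) rep R A (x - y) `^ (s - 1).
Proof.
rewrite (sum_sub A (fun w => rep R A w `^ (s - 1))) /energy.
have -> : [set w : G | shift_inter A w != fset0] = [set` diffs A].
  by apply/seteqP; split => w /=; rewrite shift_inter_neq0.
rewrite -fsbig_seq //; apply: eq_big_seq => w wD.
have r0 := rep_gt0 wD; rewrite card_shift_inter.
by rewrite -{2}[rep R A w]powRr1 ?ltW // -powRD ?(gt_eqF r0) ?implybT // addrC subrK.
Qed.

Lemma level_setE A (D : R) :
  level_set A D = [set w | (D / 2 < rep R A w) && (rep R A w <= D)].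
Proof.
rewrite /level_set; apply/seteqP; split => w /=; rewrite card_shift_inter.
  by move=> [-> ->].
by move/andP.
Qed.

Lemma level_set_sub A (D : R) : 0 < D -> level_set A D `<=` [set` diffs A].
Proof.
move=> D0 w [+ _]; rewrite card_shift_inter /=; apply: contraTT => /(@rep_eq0 R) ->.
by rewrite -leNgt divr_ge0 // ltW.
Qed.

Lemma sigma_onE A (P : pred G) :
  sigma_on R [set w | P w] A = \sum_(x <- A) \sum_(y <- A) (P (x - y))%:R.
Proof.
rewrite (sum_sub A (fun w => (P w)%:R)) /sigma_on.
rewrite fsbig_mkcond (fsbig_seq _ _ (fset_uniq (diffs A))).
rewrite [RHS](fsbig_widen _ setT) //; last first.
  by move=> w [_ /= /negP wD]; rewrite rep_eq0 ?mul0r.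
apply: eq_fsbigr => w _; rewrite /patch card_shift_inter.
by rewrite mem_setE -topredE /=; case: (P w); rewrite ?mulr1 ?mulr0.
Qed.

Lemma sigma_on_le_card A (D : R) : 0 < D ->
  sigma_on R (level_set A D) A <= D * (set_card (level_set A D))%:R.
Proof.
(* Finiteness makes [set_card] the true cardinality, since [fset_set] sends an infinite set to the
   empty one. *)
move=> D0; have fin : finite_set (level_set A D).
  by apply: sub_finite_set (level_set_sub D0) _; exact: finite_fset.
rewrite /sigma_on fsbig_finite // /set_card card_sum mulr_sumr.
rewrite !big_seq; apply: ler_sum => w; rewrite in_fset_set // inE => -[_ wD].
by rewrite mulr1.
Qed.

Lemma fsum_fset A (F : G -> R) : (forall x, x \notin A -> F x = 0) ->
  \sum_(x \in [set: G]) F x = \sum_(x <- A) F x.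
Proof.
move=> F0; rewrite (fsbig_seq _ _ (fset_uniq A)); apply/esym/fsbig_widen => //.
by move=> x [_ /= /negP xA]; exact: F0.
Qed.

Lemma popular_dualE (c : R) A P Q :
  popular_dual c A [set w | P w] [set w | Q w] = (c * energy 2 A <= quad A (fun w => (P w)%:R) (fun w => (Q w)%:R)).
Proof.
rewrite /popular_dual /=; congr (_ <= _).
have iA x : \1_[set` A] x = (x \in A)%:R :> R by rewrite indicE mem_setE.
have iP (S : pred G) x : \1_[set w | S w] x = (S x)%:R :> R.
  by rewrite indicE mem_setE.
rewrite (@fsum_fset A) => [|x xA]; last first.
  by rewrite fsbig1 // => y _; rewrite !iA (negbTE xA) mulr0 !mul0r.
rewrite /quad; apply: eq_big_seq => x xA.
rewrite (@fsum_fset A) => [|y yA]; last by rewrite !iA (negbTE yA) mulr0 mul0r.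
apply: eq_big_seq => y yA; rewrite !iA iP xA yA !mulr1.
(* With u = x + z the shift z becomes the side u - x, and y + z the fourth vertex y + (u - x). *)
rewrite (reindex_fsbigT (fun u => u - x)); last first.
  by exists (fun u => u + x) => u; rewrite ?addrK ?subrK.
rewrite (@fsum_fset A) => [|u uA]; last first.
  by rewrite !iA subrKC (negbTE uA) mulr0 mul0r.
rewrite mulr_sumr; apply: eq_big_seq => u uA.
by rewrite !iA iP subrKC uA mulr1 mulrA.
Qed.

End Translation.

(** * Parallelogram counts with weights on two sides *)

Section Parallelograms.
Variables (R : realType) (G : zmodType).
Implicit Types (A B : {fset G}) (f g : G -> R).

Lemma ler_sum_fsub A B f : (B `<=` A)%fset -> (forall x, 0 <= f x) ->
  \sum_(x <- B) f x <= \sum_(x <- A) f x.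
Proof.
move=> BA f0; rewrite (big_fsetID _ (mem B) A) /=.
have -> : [fset x in A | x \in B]%fset = B.
  by apply/fsetP => x; rewrite !inE /= andb_idl // => /(fsubsetP BA).
by rewrite lerDl; apply: sumr_ge0.
Qed.

Lemma le_fiber A f g f' g' x : (forall w, 0 <= f w <= f' w) ->
  (forall w, 0 <= g w <= g' w) -> fiber A f g x <= fiber A f' g' x.
Proof.
move=> ff gg; apply: ler_sum => y _; apply: ler_sum => u _.
apply: ler_wpM2r; rewrite ?ler0n //.
by case/andP: (ff (x - y)) => ? ?; case/andP: (gg (u - x)) => ? ?; exact: ler_pM.
Qed.

Lemma fiber_ge0 A f g x : (forall w, 0 <= f w) -> (forall w, 0 <= g w) ->
  0 <= fiber A f g x.
Proof.
move=> f0 g0; apply: sumr_ge0 => y _; apply: sumr_ge0 => u _.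
by rewrite !mulr_ge0 // ler0n.
Qed.

Lemma le_quad A f g f' g' : (forall w, 0 <= f w <= f' w) ->
  (forall w, 0 <= g w <= g' w) -> quad A f g <= quad A f' g'.
Proof. by move=> ff gg; apply: ler_sum => x _; exact: le_fiber. Qed.

(** With the second side unweighted, u only has to satisfy u + (y - x) in A, which happens
    [rep A (y - x)] times, and [rep] is even. *)
Lemma fiber_left A f x :
  fiber A f (fun=> 1) x = \sum_(y <- A) f (x - y) * rep R A (x - y).
Proof.
apply: eq_bigr => y _; rewrite -[rep R A _]repN opprB /rep mulr_sumr.
by apply: eq_bigr => u _; rewrite mulr1 addrCA.
Qed.

Lemma fiber_right A g x :
  fiber A (fun=> 1) g x = \sum_(u <- A) g (u - x) * rep R A (u - x).
Proof.
rewrite /fiber exchange_big /=; apply: eq_bigr => u _; rewrite /rep mulr_sumr.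
by apply: eq_bigr => y _; rewrite mul1r.
Qed.

Lemma quad_left A f :
  quad A f (fun=> 1) = \sum_(x <- A) \sum_(y <- A) f (x - y) * rep R A (x - y).
Proof. by apply: eq_bigr => x _; rewrite fiber_left. Qed.

Lemma quad_right A g :
  quad A (fun=> 1) g = \sum_(x <- A) \sum_(y <- A) g (x - y) * rep R A (x - y).
Proof.
rewrite exchange_big; apply: eq_bigr => x _; exact: fiber_right.
Qed.

Lemma energy2E A : energy 2 A = \sum_(x <- A) \sum_(y <- A) rep R A (x - y).
Proof.
rewrite energyE; apply: eq_bigr => x _; apply: eq_bigr => y _.
by rewrite (_ : 2 - 1 = 1 :> R) ?powRr1 ?rep_ge0 //; ring.
Qed.

Lemma quad1 A : quad A (fun=> 1) (fun=> 1) = energy 2 A :> R.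
Proof.
rewrite quad_left energy2E; apply: eq_bigr => x _; apply: eq_bigr => y _.
by rewrite mul1r.
Qed.

Lemma rep_fsub A B w : (B `<=` A)%fset -> rep R B w <= rep R A w.
Proof.
move=> BA; apply: le_trans (ler_sum_fsub BA _) => [|x]; last by rewrite ler0n.
apply: ler_sum => x _; rewrite ler_nat.
by case: (boolP (x + w \in B)) => // /(fsubsetP BA) ->.
Qed.

(** Only the vertex x is kept in B; the other three are released into A, so that what is known about
    fibers of A at points of B can be applied. *)
Lemma quad_fsub A B f g : (B `<=` A)%fset -> (forall w, 0 <= f w) ->
  (forall w, 0 <= g w) -> quad B f g <= \sum_(x <- B) fiber A f g x.
Proof.
move=> BA f0 g0; apply: ler_sum => x _.
have t0 y u : 0 <= f (x - y) * g (u - x) * (y + (u - x) \in A)%:R.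
  by rewrite !mulr_ge0 // ler0n.
apply: le_trans (ler_sum_fsub BA _) => [|y]; last exact: sumr_ge0.
apply: ler_sum => y _; apply: le_trans (ler_sum_fsub BA (t0 y)).
apply: ler_sum => u _; apply: ler_wpM2l; first by rewrite mulr_ge0.
by rewrite ler_nat; case: (boolP (_ \in B)) => // /(fsubsetP BA) ->.
Qed.

Lemma quad_suml A (K : nat) (f : 'I_K -> G -> R) g :
  quad A (fun w => \sum_(i < K) f i w) g = \sum_(i < K) quad A (f i) g.
Proof.
rewrite /quad /fiber [RHS]exchange_big; apply: eq_bigr => x _ /=.
rewrite [RHS]exchange_big; apply: eq_bigr => y _ /=.
rewrite [RHS]exchange_big; apply: eq_bigr => u _ /=.
by rewrite !mulr_suml.
Qed.

Lemma quad_sumr A (K : nat) f (g : 'I_K -> G -> R) :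
  quad A f (fun w => \sum_(i < K) g i w) = \sum_(i < K) quad A f (g i).
Proof.
rewrite /quad /fiber [RHS]exchange_big; apply: eq_bigr => x _ /=.
rewrite [RHS]exchange_big; apply: eq_bigr => y _ /=.
rewrite [RHS]exchange_big; apply: eq_bigr => u _ /=.
by rewrite mulr_sumr mulr_suml.
Qed.

Definition rich A (t : R) (w : G) : R := (t < rep R A w)%R%:R.

Definition level A (D : R) (w : G) : bool := (D / 2 < rep R A w) && (rep R A w <= D).

Definition levelr A D w : R := (level A D w)%:R.

(** A pair in B with poor difference w extends to [rep B w] <= [rep A w] <= t parallelograms. There
    are at most |B|^2 pairs, and either of the two sides may be the poor one. *)
Lemma quad_rich A B (t : R) : (B `<=` A)%fset -> 0 <= t ->
  energy 2 B - 2 * t * #|` B|%:R ^+ 2 <= quad B (rich A t) (rich A t).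
Proof.
move=> BA t0; set h := rich A t; pose h' w := 1 - h w.
have h01 w : 0 <= h w <= 1 by rewrite /h /rich; case: (_ < _); rewrite lexx ler01.
have poor : \sum_(x <- B) \sum_(y <- B) h' (x - y) * rep R B (x - y) <= t * #|` B|%:R ^+ 2.
  rewrite expr2 mulrA mulrAC (card_sum R B) mulr_sumr; apply: ler_sum => x _.
  rewrite mulr1 mulr_sumr; apply: ler_sum => y _.
  rewrite mulr1 /h' /h /rich; case: ltP => [_|le_t]; rewrite ?subrr ?mul0r ?subr0 //.
  by rewrite mul1r (le_trans (rep_fsub _ BA)).
rewrite -quad1.
(* Union bound; termwise it says that (1 - h(x - y)) (1 - h(u - x)) >= 0. *)
suff : quad B (fun=> 1) (fun=> 1) <= quad B h h + (quad B h' (fun=> 1) + quad B (fun=> 1) h').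
  by rewrite (quad_left B h') (quad_right B h') => ?; lra.
rewrite /quad -!big_split; apply: ler_sum => x _ /=.
rewrite /fiber -!big_split; apply: ler_sum => y _ /=.
rewrite -!big_split; apply: ler_sum => u _ /=.
rewrite -!mulrDl; apply: ler_wpM2r; first by rewrite ler0n.
have := h01 (x - y); have := h01 (u - x); rewrite /h'; nra.
Qed.
End Parallelograms.

(** * Dyadic levels and the choice of two of them *)

Lemma pigeonhole_sum (R : realType) (K : nat) (F : 'I_K -> R) (c : R) :
  (0 < K)%N -> c <= \sum_(i < K) F i -> exists i, c / K%:R <= F i.
Proof.
move=> K0 cF; apply: contrapT => /forallNP noF.
have k0 : 0 < K%:R :> R by rewrite ltr0n.
suff : \sum_(i < K) F i < c by rewrite ltNge cF.
have -> : c = \sum_(i < K) c / K%:R.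
  by rewrite sumr_const card_ord -[RHS]mulr_natr divfK // gt_eqF.
apply: Num.Theory.ltr_sum => [|i _]; last by rewrite ltNge; apply/negP/noF.
by apply/hasP; exists (Ordinal K0) => //; rewrite mem_index_enum.
Qed.

Section Levels.
Variables (R : realType) (G : zmodType).
Implicit Types (A B : {fset G}) (D : R).

Lemma levelr_ge0 A D w : 0 <= levelr A D w.
Proof. by rewrite /levelr ler0n. Qed.

Lemma levelrN A D w : levelr A D (- w) = levelr A D w.
Proof. by rewrite /levelr /level repN. Qed.

(** The intervals (a/2^(i+1), a/2^i] with i < K and a = |A| tile (a/2^K, a], and [rep] never exceeds
    a. *)
Lemma rich_le_sum_level A (K : nat) w :
  rich A (#|` A|%:R / 2 ^+ K) w <= \sum_(i < K) levelr A (#|` A|%:R / 2 ^+ i : R) w.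
Proof.
rewrite /rich; case: ltP => [|_]; last by apply: sumr_ge0 => i _; exact: levelr_ge0.
elim: K => [|K IH] rK; first by rewrite expr0 divr1 ltNge rep_le_card in rK.
rewrite big_ord_recr /=; case: (ltP (#|` A|%:R / 2 ^+ K) (rep R A w)) => [/IH|rle].
  by move/le_trans; apply; rewrite lerDl levelr_ge0.
rewrite {2}/levelr /level rle andbT -mulrA -invfM -exprSr rK /=.
by rewrite lerDr; apply: sumr_ge0 => i _; exact: levelr_ge0.
Qed.

(** The hypothesis makes parallelograms with a side of size at most |A|/2^K account for at most half
    of E(B). One pigeonhole per side follows. The bound after the first one is recorded separately
    because it loses K and not K^2, which later gives L^3 in the sigma product. *)
Lemma exists_levels A B (K : nat) : A != fset0 -> (B `<=` A)%fset -> (0 < K)%N ->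
  4 * (#|` A|%:R / 2 ^+ K) * #|` B|%:R ^+ 2 <= energy 2 B :> R ->
  exists D D' : R, [/\ 0 < D <= #|` A|%:R, 0 < D' <= #|` A|%:R,
    energy 2 B / (2 * K%:R) <= quad B (levelr A D) (fun=> 1) &
    energy 2 B / (2 * K%:R ^+ 2) <= quad B (levelr A D) (levelr A D')].
Proof.
move=> A0 BA K0 EB; set a : R := #|` A|%:R in EB *.
have a0 : 0 < a by rewrite ltr0n cardfs_gt0.
have k0 : 0 < K%:R :> R by rewrite ltr0n.
have D0a (i : nat) : 0 < a / 2 ^+ i <= a.
  rewrite divr_gt0 ?exprn_gt0 //= ler_pdivrMr ?exprn_gt0 // ler_peMr //.
  by rewrite exprn_ege1 ?ler1n.
pose h := rich A (a / 2 ^+ K); pose lev (i : nat) := levelr A (a / 2 ^+ i).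
have h0 w : 0 <= h w by rewrite /h /rich ler0n.
have h1 w : h w <= 1 by rewrite /h /rich lern1 leq_b1.
have hlev w : 0 <= h w <= \sum_(i < K) lev i w.
  by rewrite h0 rich_le_sum_level.
have hh : energy 2 B / 2 <= quad B h h.
  have t0 : 0 <= a / 2 ^+ K by case/andP: (D0a K) => /ltW.
  by apply: le_trans (quad_rich BA t0); rewrite -/a; lra.
have : energy 2 B / 2 <= \sum_(i < K) quad B (lev i) h.
  rewrite -quad_suml; apply: le_trans hh _.
  by apply: le_quad => // w; rewrite h0 lexx.
case/(pigeonhole_sum K0) => i Si.
have : energy 2 B / 2 / K%:R <= \sum_(j < K) quad B (lev i) (lev j).
  rewrite -quad_sumr; apply: le_trans Si _.
  by apply: le_quad => // w; rewrite levelr_ge0 lexx.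
case/(pigeonhole_sum K0) => j Nij.
exists (a / 2 ^+ i), (a / 2 ^+ j); split=> //.
  rewrite invfM mulrA; apply: le_trans Si _; apply: le_quad => w.
    by rewrite levelr_ge0 lexx.
  by rewrite h0 h1.
by rewrite invfM mulrA expr2 invfM mulrA.
Qed.

Definition popularity A (x : G) : R := \sum_(y <- A) rep R A (x - y).

Definition degree A D (x : G) : R := \sum_(y <- A) levelr A D (x - y).

Lemma popularity_ge0 A x : 0 <= popularity A x.
Proof. by apply: sumr_ge0 => y _; exact: rep_ge0. Qed.

Lemma degree_ge0 A D x : 0 <= degree A D x.
Proof. by apply: sumr_ge0 => y _; exact: levelr_ge0. Qed.

(** The condition on the fourth vertex is dropped, so the two sides at x become independent. *)
Lemma fiber_le_degree A D D' x :
  fiber A (levelr A D) (levelr A D') x <= degree A D x * degree A D' x.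
Proof.
rewrite /degree big_distrl /=; apply: ler_sum => y _; rewrite big_distrr /=.
apply: ler_sum => u _; rewrite -(levelrN _ _ (x - u)) opprB ler_piMr //.
  by rewrite mulr_ge0 ?levelr_ge0.
by rewrite lern1 leq_b1.
Qed.

Lemma degree_le_popularity A D x : 0 < D -> degree A D x <= 2 / D * popularity A x.
Proof.
move=> D0; rewrite mulr_sumr; apply: ler_sum => y _; rewrite /levelr /level.
case: ltP => /= [Dr|_]; last by rewrite mulr_ge0 ?rep_ge0 // divr_ge0 // ltW.
case: (rep R A (x - y) <= D) => /=; last by rewrite mulr_ge0 ?rep_ge0 // divr_ge0 // ltW.
by rewrite mulrAC ler_pdivlMr // mul1r mulrC -ler_pdivrMr // ltW.
Qed.

Lemma sum_degree A D : \sum_(x <- A) degree A D x = sigma_on R (level_set A D) A.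
Proof. by rewrite level_setE sigma_onE. Qed.

Lemma quad_level_le_sigma A D :
  quad A (levelr A D) (fun=> 1) <= D * sigma_on R (level_set A D) A.
Proof.
rewrite quad_left -sum_degree mulr_sumr; apply: ler_sum => x _.
rewrite mulr_sumr; apply: ler_sum => y _; rewrite /levelr /level.
by case: (_ < _); case: (leP (rep R A (x - y)) D) => rD /=; rewrite ?mul0r ?mulr0 // mul1r mulr1.
Qed.
End Levels.

(** * The number of dyadic scales *)

Lemma log2_ge2 (R : realType) (y : R) : 4 <= y -> 2 <= log2 y.
Proof.
move=> y4; have l0 : 0 < ln 2 :> R by rewrite ln_gt0 // ltr1n.
rewrite /log2 ler_pdivlMr // mulr_natl -lnXn // ler_ln ?posrE //; lra.
Qed.

(** K is the integer part of 2 log y: the upper bound on K limits the pigeonhole loss, and K + 1 > 2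
    log y makes the lowest scale small enough. *)
Lemma exists_dyadic_scale (R : realType) (y : R) : 4 <= y ->
  exists K : nat, [/\ (0 < K)%N, K%:R <= 2 * log2 y & y ^+ 2 <= 2 * 2 ^+ K].
Proof.
move=> y4; have L2 := log2_ge2 y4; have l0 : 0 < ln 2 :> R by rewrite ln_gt0 // ltr1n.
have y0 : 0 < y by lra.
have L0 : 0 <= 2 * log2 y by lra.
have /andP[KL LK] := truncn_itv L0.
exists (Num.trunc (2 * log2 y)); set K := Num.trunc _ in KL LK *; split=> //.
  by rewrite -(ltr_nat R) -(ltrD2r 1) add0r natr1; apply: le_lt_trans LK; lra.
rewrite -exprS -ler_ln ?posrE ?exprn_gt0 // !lnXn // -[leLHS]mulr_natl -[leRHS]mulr_natl.
by rewrite -ler_pdivrMr // -mulrA ltW.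
Qed.

(** * Vertices of bounded popularity *)

Section Bounds.
Variables (R : realType) (G : zmodType).
Implicit Types (A B : {fset G}).

Lemma sum_popularity A : \sum_(x <- A) popularity R A x = energy 2 A.
Proof. by rewrite energy2E. Qed.

Lemma energy2_ge A : #|` A|%:R ^+ 2 <= energy 2 A :> R.
Proof.
rewrite energy2E expr2 {1}(card_sum R A) mulr_suml big_seq [leRHS]big_seq.
apply: ler_sum => x xA; rewrite mul1r card_sum big_seq [leRHS]big_seq.
by apply: ler_sum => y yA; exact: rep_sub_ge1.
Qed.

Lemma energy2_le A : energy 2 A <= #|` A|%:R ^+ 3 :> R.
Proof.
rewrite energy2E exprS expr2 {1}(card_sum R A) mulr_suml.
apply: ler_sum => x xA; rewrite mul1r {1}(card_sum R A) mulr_suml.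
by apply: ler_sum => y yA; rewrite mul1r rep_le_card.
Qed.

Definition typical A : {fset G} :=
  [fset x in A | popularity R A x <= 4 * energy 2 A / #|` A|%:R]%fset.

Lemma typical_sub A : (typical A `<=` A)%fset.
Proof. by apply/fsubsetP => x; rewrite !inE => /andP[]. Qed.

Lemma typical_popularity A x : x \in typical A ->
  popularity R A x <= 4 * energy 2 A / #|` A|%:R.
Proof. by rewrite !inE => /andP[]. Qed.

(** Each discarded vertex has popularity above T = 4E/|A|, so dropping it from the sum of e(x) - T
    over A only lowers that sum. This sharpens Markov's inequality. *)
Lemma sum_typical_popularity A : A != fset0 ->
  \sum_(x <- typical A) popularity R A x
    <= energy 2 A * (4 * (#|` typical A|%:R / #|` A|%:R) - 3).
Proof.
move=> A0; have a0 : 0 < #|` A|%:R :> R by rewrite ltr0n cardfs_gt0.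
pose T : R := 4 * energy 2 A / #|` A|%:R.
have sumT B : \sum_(x <- B) T = T * #|` B|%:R.
  by rewrite card_sum mulr_sumr; apply: eq_bigr => x _; rewrite mulr1.
have : \sum_(x <- typical A) (popularity R A x - T)
    <= \sum_(x <- A) (popularity R A x - T).
  rewrite /typical -big_fset_condE /= [leLHS]big_mkcond /=; apply: ler_sum => x _.
  by rewrite -/T; case: (leP (popularity R A x) T) => // /ltW; rewrite subr_ge0.
rewrite !sumrB !sumT sum_popularity {2}/T divfK ?gt_eqF // => le.
have -> : energy 2 A * (4 * (#|` typical A|%:R / #|` A|%:R) - 3)
    = energy 2 A - 4 * energy 2 A + T * #|` typical A|%:R by rewrite /T; ring.
by rewrite -lerBlDr.
Qed.

Section Connected.
Variables (A : {fset G}) (beta gamma : R).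
Hypothesis (A0 : A != fset0).
Local Notation E := (energy 2 A : R).
Local Notation a := (#|` A|%:R : R).
Local Notation b := (#|` typical A|%:R / #|` A|%:R : R).

Lemma card_gt0R : 0 < a.
Proof. by rewrite ltr0n cardfs_gt0. Qed.

Lemma energy2_gt0 : 0 < E.
Proof. by apply: lt_le_trans (energy2_ge A); rewrite exprn_gt0 // card_gt0R. Qed.

Lemma typical_density : 3 / 4 <= b <= 1.
Proof.
have a0 := card_gt0R; have E0 := energy2_gt0; apply/andP; split; last first.
  by rewrite ler_pdivrMr // mul1r ler_nat fsubset_leq_card // typical_sub.
have : 0 <= E * (4 * b - 3).
  apply: le_trans (sum_typical_popularity A0).
  by apply: sumr_ge0 => x _; exact: popularity_ge0.
rewrite pmulr_rge0 //; lra.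
Qed.

Lemma sum_typical_popularity_le : \sum_(x <- typical A) popularity R A x <= E * b ^+ 4.
Proof.
apply: le_trans (sum_typical_popularity A0) _; rewrite ler_pM2l ?energy2_gt0 //.
have := sqr_ge0 (b ^+ 2 - 1); have := sqr_ge0 (b - 1).
set c := b; rewrite -subr_ge0 => h1; rewrite -subr_ge0 => h2; rewrite -subr_ge0.
have -> : c ^+ 4 - (4 * c - 3) = (c ^+ 2 - 1) ^+ 2 + 2 * (c - 1) ^+ 2 by ring.
lra.
Qed.

Hypotheses (hconn : energy_connected 2 beta gamma A) (hbeta : beta <= 1 / 2).

Lemma energy_typical : gamma * b ^+ 4 * E <= energy 2 (typical A).
Proof.
have a0 := card_gt0R; have /andP[b34 _] := typical_density.
have := hconn (typical_sub A); rewrite (_ : 2 * 2 = 4%:R); last by rewrite -natrM.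
rewrite powR_mulrn ?divr_ge0 ?ler0n //; apply.
by rewrite -ler_pdivlMr //; apply: le_trans hbeta (le_trans _ b34); lra.
Qed.

End Connected.
End Bounds.

(** * Upper bounds for popular parallelograms on typical vertices *)

Section TypicalQuad.
Variables (R : realType) (G : zmodType) (A : {fset G}) (D D' : R).
Hypotheses (A0 : A != fset0) (D0 : 0 < D) (D'0 : 0 < D').
Local Notation E := (energy 2 A : R).
Local Notation a := (#|` A|%:R : R).
Local Notation b := (#|` typical R A|%:R / #|` A|%:R : R).
Local Notation N := (quad (typical R A) (levelr A D) (levelr A D')).

Lemma quad_typical_le_degree :
  N <= \sum_(x <- typical R A) degree A D x * degree A D' x.
Proof.
apply: le_trans (quad_fsub (typical_sub R A) _ _) _; try exact: levelr_ge0.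
by apply: ler_sum => x _; exact: fiber_le_degree.
Qed.

(** The two degrees at x are at most 2e(x)/D and 2e(x)/D'. In e(x)^2 one factor is bounded by 4E/a,
    and the other is summed to at most E b^4. *)
Lemma quad_typical_le : N * (D * D' * a) <= 16 * E ^+ 2 * b ^+ 4.
Proof.
have a0 := card_gt0R R A0; have E0 := energy2_gt0 R A0.
rewrite -ler_pdivlMr ?mulr_gt0 //; apply: le_trans quad_typical_le_degree _.
pose c : R := 2 / D * (2 / D') * (4 * E / a).
have c0 : 0 <= c by rewrite /c !mulr_ge0 ?invr_ge0 ?ler0n ?ltW.
have -> : 16 * E ^+ 2 * b ^+ 4 / (D * D' * a) = c * (E * b ^+ 4).
  rewrite /c; set bb := b; field; rewrite !gt_eqF //.
apply: le_trans (ler_wpM2l c0 (sum_typical_popularity_le R A0)).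
rewrite mulr_sumr big_seq [leRHS]big_seq; apply: ler_sum => x xB.
have p0 := popularity_ge0 R A x; have pT := typical_popularity xB.
apply: le_trans (ler_pM (degree_ge0 _ _ _) (degree_ge0 _ _ _)
  (degree_le_popularity _ _ D0) (degree_le_popularity _ _ D'0)) _.
rewrite mulrACA /c -[leRHS]mulrA; apply: ler_wpM2l.
  by rewrite mulr_ge0 ?divr_ge0 ?ltW.
exact: ler_wpM2r.
Qed.

(** Here only the D-degree is bounded uniformly, by (2/D)(4E/a); the D'-degree is summed and gives
    sigma. *)
Lemma quad_typical_le_sigma : N * (a * D) <= 8 * E * sigma_on R (level_set A D') A.
Proof.
have a0 := card_gt0R R A0; have E0 := energy2_gt0 R A0.
rewrite -ler_pdivlMr ?mulr_gt0 //; apply: le_trans quad_typical_le_degree _.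
pose c : R := 2 / D * (4 * E / a).
have c0 : 0 <= c by rewrite /c !mulr_ge0 ?invr_ge0 ?ler0n ?ltW.
have -> : 8 * E * sigma_on R (level_set A D') A / (a * D)
    = c * sigma_on R (level_set A D') A.
  by rewrite /c; field; rewrite !gt_eqF.
rewrite -sum_degree; apply: le_trans (ler_wpM2l c0
  (ler_sum_fsub (typical_sub R A) (degree_ge0 A D'))).
rewrite mulr_sumr big_seq [leRHS]big_seq; apply: ler_sum => x xB.
apply: ler_wpM2r; first exact: degree_ge0.
apply: le_trans (degree_le_popularity _ _ D0) _; rewrite ler_pM2l ?divr_gt0 //.
exact: typical_popularity.
Qed.

End TypicalQuad.

(** Arithmetic only. The bound on p p' comes from s s' <= D D' p p' by dividing the lower bound for
    s s' by the upper bound for D D': 2^13 2^8 = 2^21, L^3 L^2 = L^5 and g^2 g = g^3. *)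
Lemma popular_levels_conclusion (R : realType) (E a L g D D' N p p' s s' : R) :
  0 < E -> 0 < a -> 0 < L -> 0 < g -> 0 < D -> 0 < D' -> 0 <= s -> 0 <= s' ->
  g * E <= 64 * L ^+ 2 * N ->
  D * D' * (g * a) <= 2 ^+ 8 * L ^+ 2 * E ->
  g ^+ 2 * E * a <= 2 ^+ 13 * L ^+ 3 * (s * s') ->
  s <= D * p -> s' <= D' * p' ->
  [/\ 2 ^- 6 * g * L ^- 2 * E <= N,
      D * D' <= 2 ^+ 8 * L ^+ 2 * E / (g * a),
      L ^- 5 * g ^+ 3 * 2 ^- 21 * a ^+ 2 <= p * p' &
      L ^- 3 * g ^+ 2 * 2 ^- 13 * E * a <= s * s'].
Proof.
move=> E0 a0 L0 g0 D0 D'0 s0 s'0 h1 h2 h3 h4 h5.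
have gt := exprn_gt0; split.
- have -> : 2 ^- 6 * g * L ^- 2 * E = g * E / (64 * L ^+ 2).
    by field; rewrite gt_eqF.
  by rewrite ler_pdivrMr ?mulr_gt0 ?gt // [leRHS]mulrC.
- by rewrite ler_pdivlMr // mulr_gt0.
- have -> : L ^- 5 * g ^+ 3 * 2 ^- 21 * a ^+ 2 = g ^+ 3 * a ^+ 2 / (2 ^+ 21 * L ^+ 5).
    by field; rewrite gt_eqF.
  rewrite ler_pdivrMr ?mulr_gt0 ?gt // -(ler_pM2l E0).
  have pp : s * s' <= D * D' * (p * p') by rewrite mulrACA ler_pM.
  have pp0 : 0 <= p * p'.
    by rewrite -(pmulr_rge0 _ (mulr_gt0 D0 D'0)); apply: le_trans pp; rewrite mulr_ge0.
  have -> : E * (g ^+ 3 * a ^+ 2) = g ^+ 2 * E * a * (g * a) by ring.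
  apply: (@le_trans _ _ (2 ^+ 13 * L ^+ 3 * (D * D' * (p * p')) * (g * a))).
    apply: ler_wpM2r; first by rewrite ltW // mulr_gt0.
    by apply: le_trans h3 _; rewrite ler_pM2l // mulr_gt0 ?gt.
  have -> : 2 ^+ 13 * L ^+ 3 * (D * D' * (p * p')) * (g * a)
     = 2 ^+ 13 * L ^+ 3 * (p * p') * (D * D' * (g * a)) by ring.
  have -> : E * (p * p' * (2 ^+ 21 * L ^+ 5))
     = 2 ^+ 13 * L ^+ 3 * (p * p') * (2 ^+ 8 * L ^+ 2 * E) by ring.
  apply: ler_wpM2l h2; apply: mulr_ge0 pp0.
  by apply: mulr_ge0; rewrite exprn_ge0 // ltW.
- have -> : L ^- 3 * g ^+ 2 * 2 ^- 13 * E * a = g ^+ 2 * E * a / (2 ^+ 13 * L ^+ 3).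
    by field; rewrite gt_eqF.
  by rewrite ler_pdivrMr ?mulr_gt0 ?gt // [leRHS]mulrC.
Qed.

(** * Popular levels of a connected set *)

Section MainBounds.
Variables (R : realType) (G : zmodType) (A : {fset G}).
Hypothesis (A0 : A != fset0).
Local Notation E := (energy 2 A : R).
Local Notation a := (#|` A|%:R : R).
Local Notation L := (log2 (4 * a ^+ 3 * E^-1)).

Lemma energy_ratio_ge4 : 4 <= 4 * a ^+ 3 * E^-1.
Proof.
by rewrite ler_pdivlMr ?energy2_gt0 // ler_pM2l // energy2_le.
Qed.

(** With y = 4a^3/E the scale K gives 8a^6 <= E^2 2^K, so the hypothesis on B yields 4(a/2^K)|B|^2
    <= E(B). Since K <= 2L, the losses 2K and 2K^2 become 4L and 8L^2. *)
Lemma exists_rich_levels B : (B `<=` A)%fset ->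
  E ^+ 2 * #|` B|%:R ^+ 2 <= 2 * a ^+ 5 * energy 2 B ->
  exists D D' : R, [/\ 0 < D <= a, 0 < D' <= a,
    energy 2 B <= 4 * L * quad B (levelr A D) (fun=> 1) &
    energy 2 B <= 8 * L ^+ 2 * quad B (levelr A D) (levelr A D')].
Proof.
move=> BA EB; have a0 := card_gt0R R A0; have E0 := energy2_gt0 R A0.
have L2 := log2_ge2 energy_ratio_ge4.
have [K [K0 KL yK]] := exists_dyadic_scale energy_ratio_ge4.
have k0 : 0 < K%:R :> R by rewrite ltr0n.
have q0 : 0 < 2 ^+ K :> R by rewrite exprn_gt0.
have {yK} aEK : 8 * a ^+ 6 <= E ^+ 2 * 2 ^+ K.
  move: yK; have -> : (4 * a ^+ 3 * E^-1) ^+ 2 = 16 * a ^+ 6 / E ^+ 2.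
    by field; rewrite gt_eqF.
  by rewrite ler_pdivrMr ?exprn_gt0 // => ?; lra.
have EB0 : 0 <= energy 2 B :> R.
  by apply: le_trans (energy2_ge R B); rewrite exprn_ge0 ?ler0n.
have : 4 * (a / 2 ^+ K) * #|` B|%:R ^+ 2 <= energy 2 B.
  rewrite [_ * (a / _)]mulrA mulrAC ler_pdivrMr //.
  rewrite -(ler_pM2l (exprn_gt0 2 E0)) -(ler_pM2l (exprn_gt0 5 a0)).
  apply: (@le_trans _ _ (8 * a ^+ 6 * (a ^+ 5 * energy 2 B))); last first.
    have -> : a ^+ 5 * (E ^+ 2 * (energy 2 B * 2 ^+ K))
      = E ^+ 2 * 2 ^+ K * (a ^+ 5 * energy 2 B) by ring.
    by apply: ler_wpM2r => //; rewrite mulr_ge0 // exprn_ge0 // ltW.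
  have -> : a ^+ 5 * (E ^+ 2 * (4 * a * #|` B|%:R ^+ 2))
    = 4 * a ^+ 6 * (E ^+ 2 * #|` B|%:R ^+ 2) by ring.
  have -> : 8 * a ^+ 6 * (a ^+ 5 * energy 2 B)
    = 4 * a ^+ 6 * (2 * a ^+ 5 * energy 2 B) by ring.
  by rewrite ler_pM2l // mulr_gt0 ?exprn_gt0.
case/(exists_levels A0 BA K0) => D [D' [Da D'a SD ND]].
exists D, D'; split=> //.
  move: SD; rewrite ler_pdivrMr ?mulr_gt0 // => /le_trans; apply.
  rewrite mulrC; apply: ler_wpM2r; last by lra.
  by apply: sumr_ge0 => x _; apply: fiber_ge0 => w //; exact: levelr_ge0.
move: ND; rewrite ler_pdivrMr ?mulr_gt0 ?exprn_gt0 // => /le_trans; apply.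
rewrite mulrC; apply: ler_wpM2r.
  by apply: sumr_ge0 => x _; apply: fiber_ge0 => w //; exact: levelr_ge0.
have : K%:R ^+ 2 <= (2 * L) ^+ 2 by rewrite ler_sqr ?nnegrE ?ler0n //; lra.
by rewrite exprMn => ?; lra.
Qed.

Lemma exists_popular_levels (beta gamma : R) :
  0 < gamma -> gamma <= 1 -> energy_connected 2 beta gamma A -> beta <= 1 / 2 ->
  exists D D' : R, [/\ 0 < D, 0 < D',
    gamma * E <= 64 * L ^+ 2 * quad A (levelr A D) (levelr A D'),
    D * D' * (gamma * a) <= 2 ^+ 8 * L ^+ 2 * E &
    gamma ^+ 2 * E * a <= 2 ^+ 13 * L ^+ 3 *
      (sigma_on R (level_set A D) A * sigma_on R (level_set A D') A)].
Proof.
move=> g0 g1 conn beta2.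
have a0 := card_gt0R R A0; have E0 := energy2_gt0 R A0.
have rich_levels := exists_rich_levels; have := log2_ge2 energy_ratio_ge4.
move: (L) rich_levels => l rich_levels l2; have l0 : 0 < l by lra.
have Ea := energy2_le R A.
have s0 (D : R) : 0 <= sigma_on R (level_set A D) A.
  by rewrite -sum_degree; apply: sumr_ge0 => x _; exact: degree_ge0.
(* If gamma a^3 <= E, then B = A works: [exists_rich_levels] needs only E <= 2a^3, and D D' <= a^2
   already gives D D' gamma a <= E. *)
have [gE|Eg] := leP (gamma * a ^+ 3) E.
  have [|D [D' [/andP[D0 Da] /andP[D'0 D'a] SD ND]]] := rich_levels _ (fsubset_refl A).
    have -> : 2 * a ^+ 5 * E = E * a ^+ 2 * (2 * a ^+ 3) by ring.
    have -> : E ^+ 2 * a ^+ 2 = E * a ^+ 2 * E by ring.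
    rewrite ler_pM2l ?mulr_gt0 ?exprn_gt0 //.
    have := exprn_gt0 3 a0; lra.
  exists D, D'; split=> //.
  - have : 0 <= quad A (levelr A D) (levelr A D').
      by apply: sumr_ge0 => x _; apply: fiber_ge0 => w; exact: levelr_ge0.
    move: ND; set N := quad _ _ _ => ND N0.
    have : gamma * E <= 1 * E by rewrite ler_pM2r.
    have : 0 <= l ^+ 2 * N by rewrite mulr_ge0 ?exprn_ge0 // ltW.
    by move=> ? ?; lra.
  - have DD : D * D' <= a * a by rewrite ler_pM // ltW.
    apply: (@le_trans _ _ (gamma * a ^+ 3)).
      rewrite (_ : gamma * a ^+ 3 = a * a * (gamma * a)); last by ring.
      by rewrite ler_pM2r // mulr_gt0.
    apply: le_trans gE _; rewrite ler_peMl // ?ltW //.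
    have : 1 <= l ^+ 2 by rewrite exprn_ege1 //; lra.
    by move=> ?; lra.
  (* Replacing D and D' by a and multiplying gives E^2 <= 32 l^3 a^2 s s', while gamma^2 E a^3 <=
     E^2 in this case. *)
  - have S1 : E <= 4 * l * (a * sigma_on R (level_set A D) A).
      apply: le_trans SD _; rewrite ler_pM2l ?mulr_gt0 //.
      apply: le_trans (quad_level_le_sigma A D) _; exact: ler_wpM2r.
    have N1 : E <= 8 * l ^+ 2 * (a * sigma_on R (level_set A D') A).
      apply: le_trans ND _; rewrite ler_pM2l ?mulr_gt0 ?exprn_gt0 //.
      apply: (@le_trans _ _ (quad A (levelr A D') (fun=> 1))).
        rewrite quad_left -quad_right; apply: le_quad => w; rewrite levelr_ge0 ?lexx //.
        by rewrite /levelr lern1 leq_b1.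
      apply: le_trans (quad_level_le_sigma A D') _; exact: ler_wpM2r.
    have := ler_pM (ltW E0) (ltW E0) S1 N1.
    have := s0 D; have := s0 D'.
    set s' := sigma_on _ _ _; set s := sigma_on _ _ _ => s'0 {}s0.
    have -> : 4 * l * (a * s) * (8 * l ^+ 2 * (a * s')) = a ^+ 2 * (32 * l ^+ 3 * (s * s')) by ring.
    move=> EE; rewrite -(ler_pM2l (exprn_gt0 2 a0)).
    have gg : gamma ^+ 2 * E * a * a ^+ 2 <= E * E.
      have -> : gamma ^+ 2 * E * a * a ^+ 2 = gamma * (E * (gamma * a ^+ 3)) by ring.
      apply: (@le_trans _ _ (1 * (E * E))); last by rewrite mul1r.
      by apply: ler_pM; rewrite ?ler_pM2l // ?ltW // !mulr_gt0 ?exprn_gt0.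
    rewrite mulrC; apply: le_trans gg (le_trans EE _).
    rewrite ler_pM2l ?exprn_gt0 //.
    have : 0 <= l ^+ 3 * (s * s').
      by apply: mulr_ge0; [rewrite exprn_ge0 // ltW | rewrite mulr_ge0].
    by move=> ?; lra.
(* Now E < gamma a^3 and B is the typical set. As E(B) >= gamma b^4 E, the hypothesis of
   [exists_rich_levels] reduces to E <= 2 b^2 gamma a^3, which holds because b^2 >= 1/2. *)
have Eb := energy_typical A0 conn beta2; have /andP[b34 b1] := typical_density R A0.
move: Eb b34 b1; move bE : (_ / _ : R) => b Eb b34 b1.
have b0 : 0 < b by lra.
have b2 : 1 / 2 <= b ^+ 2 by nra.
have [|D [D' [/andP[D0 Da] /andP[D'0 D'a] SD ND]]] := rich_levels _ (typical_sub R A).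
  rewrite (_ : #|` typical R A|%:R = b * a); last by rewrite -bE divfK ?gt_eqF.
  apply: (@le_trans _ _ (2 * a ^+ 5 * (gamma * b ^+ 4 * E))); last first.
    by rewrite ler_pM2l // mulr_gt0 ?exprn_gt0.
  have -> : E ^+ 2 * (b * a) ^+ 2 = E * b ^+ 2 * a ^+ 2 * E by ring.
  have -> : 2 * a ^+ 5 * (gamma * b ^+ 4 * E)
     = E * b ^+ 2 * a ^+ 2 * (2 * b ^+ 2 * (gamma * a ^+ 3)) by ring.
  rewrite ler_pM2l ?mulr_gt0 ?exprn_gt0 //.
  have : 0 < gamma * a ^+ 3 by rewrite mulr_gt0 ?exprn_gt0.
  by nra.
exists D, D'.
have NA : quad (typical R A) (levelr A D) (levelr A D') <= quad A (levelr A D) (levelr A D').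
  apply: le_trans (quad_fsub (typical_sub R A) _ _) _; try exact: levelr_ge0.
  by apply: ler_sum_fsub (typical_sub R A) _ => x; apply: fiber_ge0; exact: levelr_ge0.
have SA : quad (typical R A) (levelr A D) (fun=> 1) <= D * sigma_on R (level_set A D) A.
  apply: le_trans (quad_level_le_sigma A D).
  apply: le_trans (quad_fsub (typical_sub R A) _ _) _ => //; try exact: levelr_ge0.
  by apply: ler_sum_fsub (typical_sub R A) _ => x; apply: fiber_ge0 => // w; exact: levelr_ge0.
have N1 := quad_typical_le A0 D0 D'0; have N2 := quad_typical_le_sigma D' A0 D0.
move: SD SA ND NA N1 N2; rewrite bE.
set N := quad (typical R A) _ (levelr A D'); set S := quad _ _ (fun=> 1).
set s := sigma_on _ _ _; set s' := sigma_on _ _ _ => SD SA ND NA N1 N2.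
have lsq : 0 < l ^+ 2 by rewrite exprn_gt0.
have l3 : 0 < l ^+ 3 by rewrite exprn_gt0.
have b4 : 1 / 4 <= b ^+ 4.
  by rewrite (_ : b ^+ 4 = b ^+ 2 * b ^+ 2); [nra|ring].
have gE0 : 0 < gamma * E by rewrite mulr_gt0.
have ND' : gamma * b ^+ 4 * E <= 8 * l ^+ 2 * N by exact: le_trans Eb ND.
split=> //.
- apply: (@le_trans _ _ (64 * l ^+ 2 * N)); last by rewrite ler_pM2l ?mulr_gt0.
  have : 1 / 4 * (gamma * E) <= b ^+ 4 * (gamma * E) by rewrite ler_pM2r.
  by move=> ?; lra.
(* Both bounds for N carry the factor b^4, which cancels and leaves the constant 8 * 16 = 2^7. *)
- have EE : 0 < E * b ^+ 4 by rewrite mulr_gt0 ?exprn_gt0.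
  rewrite -(ler_pM2l EE).
  have -> : E * b ^+ 4 * (D * D' * (gamma * a)) = gamma * b ^+ 4 * E * (D * D' * a) by ring.
  have DDa : 0 < D * D' * a by rewrite !mulr_gt0.
  apply: le_trans (ler_wpM2r (ltW DDa) ND') _.
  have -> : 8 * l ^+ 2 * N * (D * D' * a) = 8 * l ^+ 2 * (N * (D * D' * a)) by ring.
  apply: (@le_trans _ _ (8 * l ^+ 2 * (16 * E ^+ 2 * b ^+ 4))).
    by rewrite ler_pM2l ?mulr_gt0.
  have : 0 < l ^+ 2 * (E * b ^+ 4 * E) by rewrite !mulr_gt0 // exprn_gt0.
  by move=> ?; lra.
(* The product of [S1] and [ND'] contains D s N, and [N2] trades N a D for 8 E s', which removes D.
   Then b^8 >= 1/16 turns 256 into 2^12. *)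
- have S1 : gamma * b ^+ 4 * E <= 4 * l * (D * s).
    by apply: le_trans Eb (le_trans SD _); rewrite ler_pM2l ?mulr_gt0.
  have x0 : 0 <= gamma * b ^+ 4 * E by rewrite ltW // !mulr_gt0 ?exprn_gt0.
  have P1 := ler_pM x0 x0 S1 ND'.
  have P2 : 32 * l ^+ 3 * s * (N * (a * D)) <= 32 * l ^+ 3 * s * (8 * E * s').
    by apply: ler_wpM2l => //; rewrite !mulr_ge0 ?s0 // ltW.
  have P3 : (gamma * b ^+ 4 * E) * (gamma * b ^+ 4 * E) * a
      <= 32 * l ^+ 3 * s * (8 * E * s').
    apply: le_trans P2; rewrite (_ : 32 * l ^+ 3 * s * (N * (a * D)) =
      4 * l * (D * s) * (8 * l ^+ 2 * N) * a); last by ring.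
    by rewrite ler_pM2r.
  have b8 : 1 / 16 <= b ^+ 4 * b ^+ 4 by nra.
  have P4 : 1 / 16 * (gamma ^+ 2 * E * a) <= b ^+ 4 * b ^+ 4 * (gamma ^+ 2 * E * a).
    by rewrite ler_pM2r // !mulr_gt0 // exprn_gt0.
  have P5 : b ^+ 4 * b ^+ 4 * (gamma ^+ 2 * E * a) <= 256 * l ^+ 3 * (s * s').
    rewrite -(ler_pM2l E0); apply: le_trans (le_trans _ P3) _.
      by rewrite le_eqVlt; apply/orP; left; apply/eqP; ring.
    by rewrite le_eqVlt; apply/orP; left; apply/eqP; ring.
  have : 0 <= l ^+ 3 * (s * s') by rewrite !mulr_ge0 ?s0 // ltW.
  by move=> ?; lra.
Qed.
End MainBounds.

(* exp(-c ln t) >= 1 - c ln t >= 1 - c (t - 1). *)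
Lemma powRN_ge_tangent (R : realType) (c t : R) : 0 <= c -> 0 < t ->
  1 + c - c * t <= t `^ (- c).
Proof.
move=> c0 t0; rewrite /powR gt_eqF //; apply: le_trans (expR_ge1Dx _).
have : c * ln t <= c * (t - 1).
  by apply: ler_wpM2l => //; rewrite -[t in ln t](subrKC 1) le_ln1Dx //; lra.
by move=> ?; lra.
Qed.

(** * Lower bound for the energies of order between 1 and 2 *)

Section FractionalEnergy.
Variables (R : realType) (G : zmodType) (A : {fset G}) (s : R).
Hypotheses (A0 : A != fset0) (s1 : 1 <= s) (s2 : s <= 2).
Local Notation E := (energy 2 A : R).
Local Notation a := (#|` A|%:R : R).
Local Notation c := (1 - s / 2).

(** The tangent line of t^(-c) is taken at T = 4E/a, the same for all x. Over the e parallelograms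
    at x the products of the side sizes sum to at most e^2 <= T e, so the sum of tangent values is
    at least T^(-c) ((1 + c) e - c e). *)
Lemma fiber_powR_ge x : x \in typical R A ->
  (4 * E / a) `^ (- c) * popularity R A x
    <= fiber A (fun w => rep R A w `^ (- c)) (fun w => rep R A w `^ (- c)) x.
Proof.
move=> xB; have xA : x \in A by apply: (fsubsetP (typical_sub R A)).
have := typical_popularity xB; have a0 := card_gt0R R A0; have E0 := energy2_gt0 R A0.
have : 0 < 4 * E / a by rewrite divr_gt0 ?mulr_gt0.
move: (4 * E / a) => T T0 eT; have c0 : 0 <= c by have := s2; lra.
set e := popularity R A x in eT *; have e0 : 0 <= e := popularity_ge0 R A x.
pose q y u : R := (y + (u - x) \in A)%:R.
have q1 : \sum_(y <- A) \sum_(u <- A) q y u = e.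
  transitivity (fiber A (fun=> 1 : R) (fun=> 1) x); last first.
    by rewrite fiber_left; apply: eq_bigr => y _; rewrite mul1r.
  by apply: eq_bigr => y _; apply: eq_bigr => u _; rewrite !mul1r.
have q2 : \sum_(y <- A) \sum_(u <- A) rep R A (x - y) * rep R A (u - x) * q y u <= T * e.
  apply: (@le_trans _ _ (e * e)); last exact: ler_wpM2r.
  rewrite {1}/e /popularity mulr_suml; apply: ler_sum => y _.
  rewrite mulr_sumr; apply: ler_sum => u _; rewrite -[rep R A (x - u)]repN opprB.
  by rewrite ler_piMr ?mulr_ge0 ?rep_ge0 // /q lern1 leq_b1.
have Tc : 0 < T `^ (- c) by rewrite powR_gt0.
apply: (@le_trans _ _ (\sum_(y <- A) \sum_(u <- A) T `^ (- c) *
   ((1 + c) * q y u - c / T * (rep R A (x - y) * rep R A (u - x) * q y u)))).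
  rewrite (_ : \sum_(y <- A) _ = T `^ (- c) * ((1 + c) * e - c / T *
    \sum_(y <- A) \sum_(u <- A) rep R A (x - y) * rep R A (u - x) * q y u)); last first.
    rewrite -q1 !mulr_sumr -sumrB mulr_sumr; apply: eq_bigr => y _.
    by rewrite !mulr_sumr -sumrB mulr_sumr.
  rewrite ler_pM2l //.
  have : c / T * \sum_(y <- A) \sum_(u <- A) rep R A (x - y) * rep R A (u - x) * q y u
     <= c / T * (T * e) by apply: ler_wpM2l => //; rewrite divr_ge0 // ltW.
  rewrite [c / T * (T * e)]mulrA divfK ?gt_eqF // => ?; lra.
rewrite /fiber big_seq [leRHS]big_seq; apply: ler_sum => y yA.
rewrite big_seq [leRHS]big_seq; apply: ler_sum => u uA; rewrite -/(q y u).
have r1 : 0 < rep R A (x - y) by apply: lt_le_trans ltr01 _; exact: rep_sub_ge1.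
have r2 : 0 < rep R A (u - x) by apply: lt_le_trans ltr01 _; exact: rep_sub_ge1.
move: (rep R A (x - y)) (rep R A (u - x)) r1 r2 => r1 r2 r10 r20.
have -> : T `^ (- c) * ((1 + c) * q y u - c / T * (r1 * r2 * q y u))
    = T `^ (- c) * (1 + c - c * (r1 * r2 / T)) * q y u by ring.
apply: ler_wpM2r; first by rewrite /q ler0n.
have -> : r1 `^ (- c) * r2 `^ (- c) = T `^ (- c) * (r1 * r2 / T) `^ (- c).
  by rewrite -!powRM ?ltW ?divr_gt0 ?mulr_gt0 // [T * _]mulrC divfK ?gt_eqF.
by rewrite ler_pM2l // powRN_ge_tangent // divr_gt0 ?mulr_gt0.
Qed.

(** AM-GM separates the two sides. A squared weight r^(-2c) = r^(s - 2), times the r parallelograms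
    on that side, is r^(s - 1), the summand of [energyE]. *)
Lemma quad_powR_le :
  quad A (fun w => rep R A w `^ (- c)) (fun w => rep R A w `^ (- c)) <= energy s A.
Proof.
pose f w := rep R A w `^ (- c).
have ff : \sum_(x <- A) \sum_(y <- A) f (x - y) ^+ 2 * rep R A (x - y) = energy s A.
  rewrite energyE; apply: eq_big_seq => x xA; apply: eq_big_seq => y yA.
  have r0 : 0 < rep R A (x - y) by apply: lt_le_trans ltr01 _; exact: rep_sub_ge1.
  rewrite -[X in _ * X = _](powRr1 (ltW r0)) expr2 /f.
  by rewrite -!powRD ?(gt_eqF r0) ?implybT //; congr (_ `^ _); field.
suff : quad A f f <= 2^-1 * quad A (fun w => f w ^+ 2) (fun=> 1)
    + 2^-1 * quad A (fun=> 1) (fun w => f w ^+ 2).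
  by rewrite quad_left quad_right ff -mulrDl; move/le_trans; apply; lra.
rewrite /quad !mulr_sumr -big_split; apply: ler_sum => x _ /=.
rewrite /fiber !mulr_sumr -big_split; apply: ler_sum => y _ /=.
rewrite !mulr_sumr -big_split; apply: ler_sum => u _ /=.
rewrite !mulrA -mulrDl; apply: ler_wpM2r; first by rewrite ler0n.
have := sqr_ge0 (f (x - y) - f (u - x)); nra.
Qed.

Lemma energy_ge_typical :
  (4 * E / a) `^ (- c) * \sum_(x <- typical R A) popularity R A x <= energy s A.
Proof.
apply: le_trans quad_powR_le; rewrite mulr_sumr.
apply: (@le_trans _ _ (\sum_(x <- typical R A)
  fiber A (fun w => rep R A w `^ (- c)) (fun w => rep R A w `^ (- c)) x)).
  by rewrite big_seq [leRHS]big_seq; apply: ler_sum => x; exact: fiber_powR_ge.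
apply: ler_sum_fsub (typical_sub R A) _ => x.
by apply: fiber_ge0 => w; exact: powR_ge0.
Qed.

Lemma energy_ge_of_connected (beta gamma : R) : 0 < gamma ->
  energy_connected 2 beta gamma A -> beta <= 1 / 2 ->
  2 ^- 5 * gamma * (a `^ (1 - s / 2)) * (E `^ (s / 2)) <= energy s A.
Proof.
move=> g0 conn beta2; apply: le_trans energy_ge_typical.
have a0 := card_gt0R R A0; have E0 := energy2_gt0 R A0.
have Tc : 0 < (4 * E / a) `^ (- c) by rewrite powR_gt0 // divr_gt0 ?mulr_gt0.
have Eb := energy_typical A0 conn beta2; have /andP[b34 b1] := typical_density R A0.
(* E(B) counts parallelograms inside B, while the sum of popularities asks only for one vertex in
   B. *)
have EB : gamma * (#|` typical R A|%:R / a) ^+ 4 * E <= \sum_(x <- typical R A) popularity R A x.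
  apply: le_trans Eb _; rewrite -quad1.
  apply: le_trans (quad_fsub (typical_sub R A) _ _) _ => //.
  apply: ler_sum => x _; rewrite fiber_left; apply: ler_sum => y _.
  by rewrite mul1r.
apply: le_trans (ler_wpM2l (ltW Tc) EB).
move: (#|` typical R A|%:R / a) b34 b1 {Eb EB} => b b34 b1.
have b2 : 1 / 2 <= b ^+ 2 by nra.
have b4 : 1 / 4 <= b ^+ 4.
  by rewrite (_ : b ^+ 4 = b ^+ 2 * b ^+ 2); [nra|ring].
have -> : E `^ (s / 2) = E * E `^ (- c).
  rewrite -{2}[E](powRr1 (ltW E0)) -powRD ?(gt_eqF E0) ?implybT //.
  by congr (_ `^ _); ring.
have -> : (4 * E / a) `^ (- c) = 4 `^ (- c) * E `^ (- c) * a `^ c.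
  rewrite !powRM ?mulr_ge0 ?invr_ge0 ?ltW // -[a^-1]powR_inv1 ?ltW // -powRrM.
  by rewrite mulN1r opprK.
(* This factor and b^4 are each at least 1/4, and 1/16 exceeds the required 2^(-5). *)
have f4 : 1 / 4 <= 4 `^ (- c) :> R.
  have -> : 1 / 4 = 4 `^ (- 1) :> R by rewrite powR_inv1 ?div1r.
  by rewrite ler_powR ?ler1n //; have := s1; lra.
have z0 : 0 < gamma * a `^ c * E * E `^ (- c) by rewrite !mulr_gt0 ?powR_gt0.
have f44 : 1 / 16 <= 4 `^ (- c) * b ^+ 4 by nra.
have -> : 2 ^- 5 * gamma * a `^ c * (E * E `^ (- c))
  = 2 ^- 5 * (gamma * a `^ c * E * E `^ (- c)) by ring.
have -> : 4 `^ (- c) * E `^ (- c) * a `^ c * (gamma * b ^+ 4 * E)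
  = 4 `^ (- c) * b ^+ 4 * (gamma * a `^ c * E * E `^ (- c)) by ring.
rewrite ler_pM2r //; apply: le_trans f44; lra.
Qed.

End FractionalEnergy.

Theorem corollary46 (R : realType) (G : zmodType) (A : {fset G})
    (beta gamma : R)
    (hA : A != fset0)
    (hbeta0 : 0 <= beta) (hbeta1 : beta <= 1)
    (hgamma0 : 0 < gamma) (hgamma1 : gamma <= 1)
    (hconn : energy_connected 2 beta gamma A)
    (hbeta : beta <= 1 / 2) :
  let E : R := energy 2 A in
  let a : R := #|` A|%:R in
  let L : R := log2 (4 * a ^+ 3 * E^-1) in
  (exists Delta Deltastar : R,
    [/\ 0 < Delta, 0 < Deltastar &
      let P := level_set A Delta in
      let Pstar := level_set A Deltastar in
      [/\ popular_dual (2 ^- 6 * gamma * L ^- 2) A P Pstar,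
          Delta * Deltastar <= 2 ^+ 8 * L ^+ 2 * E / (gamma * a),
          L ^- 5 * gamma ^+ 3 * 2 ^- 21 * a ^+ 2
            <= (set_card P)%:R * (set_card Pstar)%:R &
          L ^- 3 * gamma ^+ 2 * 2 ^- 13 * E * a
            <= sigma_on R P A * sigma_on R Pstar A]]) /\
  (forall s : R, 1 <= s -> s <= 2 ->
    2 ^- 5 * gamma * (a `^ (1 - s / 2)) * (E `^ (s / 2)) <= energy s A).
Proof.
move=> E a L; split; last first.
  by move=> s s1 s2; exact: energy_ge_of_connected hconn hbeta.
have [D [D' [D0 D'0 h1 h2 h3]]] := exists_popular_levels hA hgamma0 hgamma1 hconn hbeta.
exists D, D'; split=> // P Pstar.
have a0 : 0 < a := card_gt0R R hA; have E0 : 0 < E := energy2_gt0 R hA.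
have L0 : 0 < L by apply: lt_le_trans (log2_ge2 (energy_ratio_ge4 R hA)); rewrite ltr0n.
have s0 (D1 : R) : 0 <= sigma_on R (level_set A D1) A.
  by rewrite -sum_degree; apply: sumr_ge0 => x _; exact: degree_ge0.
have [] := popular_levels_conclusion E0 a0 L0 hgamma0 D0 D'0 (s0 D) (s0 D') h1 h2 h3
  (sigma_on_le_card A D0) (sigma_on_le_card A D'0).
by split=> //; rewrite /P /Pstar !level_setE popular_dualE.
Qed.
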